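(* Let $G$ be a finitely generated group. There is a finite cyclic group $F$ and a Cayley graph of $G\times F$ with discrete isometry group.
   Context: Given a finitely generated group $\Gamma$ and a finite symmetric generating set $S$, the Cayley graph $(\Gamma,S)$ is the (simple: no loops or multiple edges, unlabelled, unoriented) graph with vertex set $\Gamma$ and distance $d(g,h)=|g^{-1}h|_S$ (word length). The isometry group of a graph is equipped with the topology of pointwise convergence; it is discrete for this topology if and only if its vertex stabilizers are finite. *)

(* Defs.v *)
From HB Require Import structures.
From mathcomp Require Import all_boot fingroup cyclic.
From mathcomp Require Import boolp classical_sets functions cardinality.
From mathcomp Require Import topology.

Set Implicit Arguments.
Unset Strict Implicit.
Unset Printing Implicit Defensive.

Local Open Scope classical_set_scope.
Local Open Scope group_scope.

Section Groups.
Variable G : groupType.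
Implicit Types (S : set G) (g h : G).

Definition generated_subgroup S : set G :=
  smallest (fun H : set G => group_closed [in H]) S.

Definition generating_set S : Prop := generated_subgroup S = [set: G].

Definition finitely_generated : Prop :=
  exists S : set G, finite_set S /\ generating_set S.

(* The neutral element is allowed in S: this changes neither word lengths nor
   the Cayley graph, which has no loops. *)
Definition finite_symmetric_generating_set S : Prop :=
  [/\ finite_set S, (forall s, S s -> S s^-1) & generating_set S].

Definition is_word_product S g (n : nat) : Prop :=
  exists w : n.-tuple G,
    (forall i, S (tnth w i)) /\ \prod_(i < n) tnth w i = g.

(* The least n such that g is a product of n elements of S; such an n exists
   when S is a symmetric generating set (the default value of xget, 0, is then
   never used). *)
Definition word_length S g : nat :=
  xget 0%N [set n | is_word_product S g n /\
                    forall m, is_word_product S g m -> (n <= m)%N].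

(* The distance of the Cayley graph of G with respect to S. The graph itself is
   recovered from it: g and h are adjacent iff cayley_dist S g h = 1. *)
Definition cayley_dist S g h : nat := word_length S (g^-1 * h).

End Groups.

Arguments finitely_generated : clear implicits.

(* The isometries of V onto itself, as a subset of the space of all maps V -> V
   with the topology of pointwise convergence, V being discrete. *)
Definition isometry_group (V : choiceType) (d : V -> V -> nat) :
    set {ptws V -> discrete_topology V} :=
  [set f : V -> V | bijective f /\ forall x y, d (f x) (f y) = d x y].

Definition discrete_space (T : topologicalType) : Prop :=
  forall A : set T, open A.

(* The coercion to set_type endows the isometry group with the topology induced
   by {ptws V -> discrete_topology V}. *)
Definition discrete_isometry_group (V : choiceType) (d : V -> V -> nat) : Prop :=
  discrete_space (set_type (isometry_group d)).

(* Main.v *)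
(* Let s be a finite symmetric generating list of G. Take F cyclic of large order
   and, over each g in s, put the edges (x, b) -- (x * g, b * t) for t in a
   three-element set A_g of F, with A_{g^-1} = A_g^-1, all edges over g = 1
   being allowed. The sets A_g are chosen so that the subset b * A_g^-1 of F
   determines both g and b. An isometry fixing the coset {x} x F pointwise sends
   (x * g, b) to a vertex with the same neighbours in that coset, hence fixes it;
   so it fixes {x * g} x F pointwise, and by connectedness an isometry
   fixing the finite set {1} x F is the identity. *)

Require Import Defs.
From mathcomp Require Import all_boot fingroup cyclic zmodp.
From mathcomp Require Import zify.
From mathcomp Require Import boolp classical_sets functions cardinality.
From mathcomp Require Import topology.

Set Implicit Arguments.
Unset Strict Implicit.
Unset Printing Implicit Defensive.

Local Open Scope classical_set_scope.
Local Open Scope group_scope.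

(** * Discreteness from a finite set with trivial pointwise stabilizer *)

Section FiniteBase.
Variables (V : choiceType) (d : V -> V -> nat).

Lemma isometry_group_cancel_comp (f g f' : V -> V) :
  isometry_group d f -> isometry_group d g -> cancel f f' -> cancel f' f ->
  isometry_group d (f' \o g).
Proof.
move=> [_ df] [bg dg] fK f'K; split.
  by apply: bij_comp bg; exists f.
by move=> x y; rewrite -df /= !f'K dg.
Qed.

Lemma open_eq_on (K : seq V) (g : V -> V) :
  open [set f : {ptws V -> discrete_topology V} | {in K, f =1 g}].
Proof.
elim: K => [|k K IH].
  rewrite (_ : [set _ | _] = setT) ?predeqE//; exact: openT.
rewrite (_ : [set _ | _] =
    [set f : {ptws V -> discrete_topology V} | f k = g k] `&`
    [set f : {ptws V -> discrete_topology V} | {in K, f =1 g}]).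
  apply: openI IH.
  have projk := iffLR (@continuousP {ptws V -> discrete_topology V}
    (discrete_topology V) _) (@proj_continuous V (fun=> discrete_topology V) k).
  by apply: (projk [set g k]); exact: discrete_open.
rewrite predeqE => f; split=> [fg|[fk fK] x].
  by split=> [|x xK]; apply: fg; rewrite inE ?eqxx ?xK ?orbT.
by rewrite inE => /predU1P[->//|/fK].
Qed.

(** Two isometries that agree on [K] differ by one fixing [K] pointwise, so they coincide; agreement
    on the finite list [K] is an open condition, hence points are open. *)
Lemma discrete_isometry_group_of_finite_base (K : seq V) :
  (forall f : V -> V, isometry_group d f -> {in K, f =1 id} -> f =1 id) ->
  discrete_isometry_group d.
Proof.
move=> baseK A; rewrite openE => f Af; rewrite /interior /= nbhsE.
pose U := [set h : {ptws V -> discrete_topology V} | {in K, h =1 \val f}].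
exists (set_val @^-1` U); first by split=> //; exists U => //; exact: open_eq_on.
move=> g /= gf; suff -> : g = f by [].
apply: val_inj; apply/funext => x.
have If : isometry_group d (\val f) := set_valP f.
have Ig : isometry_group d (\val g) := set_valP g.
have [[f' fK f'K] _] := If.
have fg_id := baseK _ (isometry_group_cancel_comp If Ig fK f'K).
rewrite -[LHS]f'K; congr (\val f _); apply: fg_id => y yK.
rewrite -[RHS]fK; congr f'; exact: gf.
Qed.

End FiniteBase.

(** * Adjacency in the Cayley graph *)

Section CayleyGraph.
Variable G : groupType.
Implicit Types (S : set G) (g : G).

Lemma word_length_eq1 S g : word_length S g = 1%N <-> S g /\ g <> 1.
Proof.
have word0 : is_word_product S g 0 <-> g = 1.
  split=> [[w [_ <-]]|->]; first by rewrite big_ord0.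
  by exists [tuple]; split; [case|rewrite big_ord0].
have word1 : is_word_product S g 1 <-> S g.
  split=> [[w [Sw <-]]|Sg]; first by rewrite big_ord1; exact: Sw.
  by exists [tuple g]; split=> [i|]; rewrite ?big_ord1 ?ord1 // tnth0.
rewrite /word_length; split=> [|[Sg g1]].
  (* The default value of [xget] is 0, so a length equal to 1 is a true minimum. *)
  case: xgetP => // n _ [wn minw] n1; rewrite n1 in wn minw.
  by split; [exact/word1|move=> /word0/minw].
apply: xget_unique; first split; [exact/word1|by case=> // /word0|].
move=> [/= [/word0//]|[//|n] [_ minn]].
by have /minn := iffRL word1 Sg.
Qed.

Lemma cayley_dist_eq1 S (g h : G) :
  cayley_dist S g h = 1%N <-> S (g^-1 * h) /\ g <> h.
Proof.
rewrite word_length_eq1; split=> -[Sgh gh]; split=> // e; apply: gh.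
  by rewrite e mulVg.
by rewrite -[g]mulg1 -e mulVKg.
Qed.

End CayleyGraph.

(** * Translates of three-point sets of powers of [z] *)

Section ThreePointSets.
Variables (F : finGroupType) (z : F).

Definition three_points (a b : nat) : seq F := [:: 1; z ^+ a; z ^- b].

(** Moving the inverse powers across leaves two exponents below the order of [z], where congruence
    is equality. *)
Lemma expg_div_inj (i j k l : nat) :
  (i + l < #[z])%N -> (k + j < #[z])%N ->
  z ^+ i * z ^- j = z ^+ k * z ^- l -> (i + l = k + j)%N.
Proof.
move=> il kj /(canRL (mulgKV _)) e.
apply/eqP; rewrite -(modn_small il) -(modn_small kj) -eq_expg_mod_order.
by rewrite !expgD e -!mulgA (commuteX2 j l (commute_refl z)) mulKg.
Qed.

Lemma three_pointsP (a b : nat) (f : F) :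
  f \in three_points a b -> exists i j : nat,
    f = z ^+ i * z ^- j /\
    (i = 0 /\ j = 0 \/ i = a /\ j = 0 \/ i = 0 /\ j = b)%N.
Proof.
rewrite !inE => /or3P[] /eqP ->.
- by exists 0%N, 0%N; rewrite invg1 mulg1; split=> //; left.
- by exists a, 0%N; rewrite invg1 mulg1; split=> //; right; left.
- by exists 0%N, b; rewrite mul1g; split=> //; right; right.
Qed.

(* On the circle Z/n with n > 3M the gap between z^a and z^-b is longer than the
   two gaps a and b around 1, so a translation matching two such sets must match
   their long gaps, hence their middle points. *)
Lemma three_points_translate (M a b a' b' : nat) (u : F) :
  (3 * M < #[z])%N -> (0 < a <= M)%N -> (0 < b <= M)%N ->
  (0 < a' <= M)%N -> (0 < b' <= M)%N ->
  {in three_points a b, forall t, t * u \in three_points a' b'} ->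
  u = 1 /\ a = a'.
Proof.
move=> zM aM bM aM' bM' sub.
have mem_sub t : t \in three_points a b ->
    exists i j : nat, t * u = z ^+ i * z ^- j /\
    (i = 0 /\ j = 0 \/ i = a' /\ j = 0 \/ i = 0 /\ j = b')%N.
  by move=> /sub/three_pointsP.
have [|i [j [+ uij]]] := mem_sub 1; rewrite ?inE ?eqxx // mul1g => u_ij.
have [|i1 [j1 [+ ij1]]] := mem_sub (z ^+ a); rewrite ?inE ?eqxx ?orbT //.
rewrite u_ij mulgA -expgD => e1.
have [|i2 [j2 [+ ij2]]] := mem_sub (z ^- b); rewrite ?inE ?eqxx ?orbT //.
rewrite u_ij.
have -> : z ^- b * (z ^+ i * z ^- j) = z ^+ i * z ^- (b + j).
  have zbi : commute (z ^- b) (z ^+ i).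
    exact/commute_sym/commuteV/commuteX2/commute_refl.
  by rewrite addnC expgD invMg !mulgA zbi.
move=> e2.
(* Each side is a sum of at most three exponents bounded by [M]: hence the factor 3. *)
have e1' : (a + i + j1 = i1 + j)%N by apply: expg_div_inj e1; lia.
have e2' : (i + j2 = i2 + (b + j))%N by apply: expg_div_inj e2; lia.
(* If [u] were [z ^+ a'], the first equation would give [a + a' + j1 = i1 <= a']; [z ^- b']
   overshoots likewise in the second. So [u = 1], and [a + j1 = i1] leaves only [a = a']. *)
have [i0 j0 ->] : [/\ i = 0, j = 0 & a = a']%N by split; lia.
by rewrite i0 j0 invg1 mulg1.
Qed.

End ThreePointSets.

(** * The generating set and the rigidity of its Cayley graph *)

Section Construction.
Variables (G : groupType) (F : finGroupType) (z : F) (s : seq G).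

(** The successor keeps labels positive; elements outside [s] all get [(size s).+1]. *)
Definition label (g : G) : nat := (index g s).+1.

(** Inverting the set swaps the two labels, which gives the symmetry in [g] and [g^-1] without
    choosing one of them. *)
Definition fibre (g : G) : seq F := three_points z (label g) (label g^-1).

Definition connection_set : set (G * F)%type :=
  [set x | x.1 = 1 \/ x.1 \in s /\ x.2 \in fibre x.1].

Lemma fibreV (g : G) (t : F) : t \in fibre g -> t^-1 \in fibre g^-1.
Proof.
rewrite !inE invgK => /or3P[] /eqP ->.
- by rewrite invg1 eqxx.
- by rewrite eqxx !orbT.
- by rewrite invgK eqxx !orbT.
Qed.

Hypothesis sV : {in s, forall g, g^-1 \in s}.

Lemma connection_setV (x : G * F) : connection_set x -> connection_set x^-1.
Proof.
case: x => g t [/= ->|[/= gs tg]]; first by left; exact: invg1.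
by right; split; [exact: sV|exact: fibreV].
Qed.

Lemma finite_connection_set : finite_set connection_set.
Proof.
apply: (@sub_finite_set _ _ ([set` 1 :: s] `*` [set: F])).
  move=> [g t] [/= ->|[/= gs _]]; split=> //=; first exact: mem_head.
  by rewrite inE gs orbT.
by apply: finite_setX => //; exact: finite_finset.
Qed.

Hypothesis gen_s : generating_set [set` s].

(** The pairs [(1, t)] are all generators, and so are the [(a, 1)] with [a] in [s], since every
    fibre contains 1. *)
Lemma generating_connection_set : generating_set connection_set.
Proof.
rewrite /generating_set predeqE => -[g t]; split=> // _ H [[H1 HV] SH].
have HM : forall x y, H x -> H y -> H (x * y).
  move=> x y Hx Hy; apply/set_mem.
  by apply: (group_closedM (conj H1 HV)); exact: mem_set.
have Hg : H (g, 1).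
  have gen_g : generated_subgroup [set` s] g by rewrite gen_s.
  apply: (gen_g [set a | H (a, 1)]); split.
    split; first exact: H1.
    move=> a b /set_mem Ha /set_mem Hb; apply/mem_set.
    have /set_mem := HV _ _ (mem_set Ha) (mem_set Hb); congr (H _).
    by congr (_, _); rewrite /= divg1.
  move=> a /= sa; apply: SH; right; split=> //=; exact: mem_head.
rewrite (_ : (g, t) = (g, 1) * (1, t)); first by apply: HM Hg _; apply: SH; left.
by congr (_, _); rewrite ?mulg1 ?mul1g.
Qed.

Hypothesis large_z : (3 * (size s).+1 < #[z])%N.

Lemma fibre_translate (g h : G) (u : F) : g \in s ->
  {in fibre g, forall t, t * u \in fibre h} -> u = 1 /\ g = h.
Proof.
move=> gs; have labelM k : (0 < label k <= (size s).+1)%N.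
  by rewrite /= ltnS index_size.
have translate := three_points_translate large_z
  (labelM g) (labelM g^-1) (labelM h) (labelM h^-1).
move=> /translate[-> [igh]]; split=> //.
by rewrite -(nth_index 1 gs) igh nth_index // -index_mem -igh index_mem.
Qed.

Let d := cayley_dist connection_set.

Lemma isometry_fix_neighbours (f : G * F -> G * F) (x g : G) :
  isometry_group d f -> g \in s ->
  (forall b, f (x, b) = (x, b)) -> forall b, f (x * g, b) = (x * g, b).
Proof.
move=> [/bij_inj finj df] gs fx b.
have [->|/eqP g1] := eqVneq g 1; first by rewrite mulg1.
case fxg: (f (x * g, b)) => [y b'].
(* The points over [x] are their own images, so injectivity keeps other images away from them. *)
have xy : x <> y.
  move=> exy; move: fxg; rewrite -exy -fx => /finj[/esym xg _].
  by apply: g1; rewrite -[g](mulKg x) -xg mulVg.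
(* The neighbours of [(x * g, b)] over [x] are the fixed points [(x, b * t^-1)] with [t] in
   [fibre g]; they must also be neighbours of [(y, b')]. *)
have translate : {in fibre g, forall t,
    x^-1 * y \in s /\ t * (b^-1 * b') \in fibre (x^-1 * y)}.
  move=> t tg.
  have /cayley_dist_eq1[] : d (x, b * t^-1) (y, b') = 1%N.
    rewrite -[(x, b * t^-1)]fx -fxg df; apply/cayley_dist_eq1; split.
      right; rewrite /= mulKg; split=> //.
      by rewrite invMg invgK mulgKV.
    by move=> [xg _]; apply: g1; rewrite -[g](mulKg x) -xg mulVg.
  rewrite /connection_set /= invMg invgK -mulgA => -[xy1|//] _.
  by case: xy; rewrite -[y](mulKVg x) xy1 mulg1.
have [t tg|u1 gxy] := @fibre_translate g (x^-1 * y) (b^-1 * b') gs.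
  by have [] := translate t tg.
by rewrite gxy mulKVg -[b'](mulKVg b) u1 mulg1.
Qed.

Lemma discrete_isometry_group_connection_set : discrete_isometry_group d.
Proof.
apply: (@discrete_isometry_group_of_finite_base _ _ [seq (1, b) | b <- enum F]).
move=> f If fix1.
pose fixed x := forall b, f (x, b) = (x, b).
have fixed_mul x g : g \in s -> fixed x <-> fixed (x * g).
  move=> gs; split=> [|fxg]; first exact: isometry_fix_neighbours.
  by rewrite -(mulgK g x); apply: isometry_fix_neighbours => //; exact: sV.
(* The equivalence, rather than one implication, makes [H] closed under division, hence a
   subgroup. *)
pose H := [set g | forall x, fixed x <-> fixed (x * g)].
have HT g : H g.
  have gen_g : generated_subgroup [set` s] g by rewrite gen_s.
  apply: (gen_g H); split; last by move=> a /= sa x; exact: fixed_mul.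
  split=> [|a b /set_mem Ha /set_mem Hb]; apply/mem_set => x.
    by rewrite mulg1.
  rewrite mulgA; split=> [/Ha|] xab.
    by apply/Hb; rewrite mulgKV.
  by apply/Ha; move/Hb: xab; rewrite mulgKV.
have fixed1 : fixed 1 by move=> b; apply: fix1; rewrite map_f // mem_enum.
by move=> [g b]; have /HT := fixed1; move/(_ g); rewrite mul1g; apply.
Qed.

End Construction.

(** * Choice of the generators and of the cyclic group *)

Lemma finitely_generated_symmetric (G : groupType) : finitely_generated G ->
  exists s : seq G, {in s, forall g, g^-1 \in s} /\ generating_set [set` s].
Proof.
move=> [S [/finite_seqP[s ->] gen_s]]; exists (s ++ [seq g^-1 | g <- s]); split.
  move=> g; rewrite !mem_cat => /orP[gs|/mapP[h hs ->]].
    by rewrite map_f ?orbT.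
  by rewrite invgK hs.
rewrite /generating_set predeqE => g; split=> // _ H [gH sH].
have : generated_subgroup [set` s] g by rewrite gen_s.
by apply; split=> // h /= hs; apply: sH; rewrite /= mem_cat hs.
Qed.

Local Close Scope group_scope.
Local Close Scope classical_set_scope.

Theorem theorem9 (G : groupType) (hG : finitely_generated G) :
  exists F : finGroupType,
    cyclic [set: F] /\
    exists S : set (G * F)%type,
      finite_symmetric_generating_set S /\
      discrete_isometry_group (cayley_dist S).
Proof.
have [s [sV gen_s]] := finitely_generated_symmetric hG.
(* Labels are at most [(size s).+1]; the order [N.+1] is the least one exceeding three times this
   bound. *)
pose N := (3 * (size s).+1)%N.
exists 'I_N.+1; split; first by rewrite Zp_cycle cycle_cyclic.
exists (connection_set (Zp1 : 'I_N.+1) s); split; last first.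
  by apply: discrete_isometry_group_connection_set => //; rewrite order_Zp1.
split; first exact: finite_connection_set.
  by move=> x; exact: connection_setV.
exact: generating_connection_set.
Qed.
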